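(* Ward linkage does not satisfy Condition A$'$ (monotonicity across merges, dissimilarity version), and neither Median linkage nor Centroid linkage satisfies Condition B$'$ (dominance preservation, dissimilarity version).
   Context: A dissimilarity function on a finite set $\mathcal{X}=\{x_1,\dots,x_k\}$ is a symmetric map $d:\mathcal{X}\times\mathcal{X}\to[0,\infty)$ with $d(x,x)<d(x,y)$ for all $x\neq y$ (not necessarily a metric). Linkage algorithm (dissimilarity version): start with active clusters $\mathcal{C}^{(0)}=\{\{x_1\},\dots,\{x_k\}\}$ and $d(\{x\},\{y\})=d(x,y)$. At each step select two distinct active clusters $t_1,t_2$ minimizing $d(t_1',t_2')$ over pairs of distinct active clusters (ties broken arbitrarily), replace them by $t_1\cup t_2$ in the set of active clusters, and for every other active cluster $t_3$ define $$d(t_1\cup t_2,t_3)=d(t_3,t_1\cup t_2)=\eta_1d(t_1,t_3)+\eta_2d(t_2,t_3)+\beta d(t_1,t_2),$$ with the following coefficients: Ward: $\eta_1=\frac{|t_1|+|t_3|}{|t_1|+|t_2|+|t_3|}$, $\eta_2=\frac{|t_2|+|t_3|}{|t_1|+|t_2|+|t_3|}$, $\beta=-\frac{|t_3|}{|t_1|+|t_2|+|t_3|}$. Median: $\eta_1=\frac{|t_1|}{|t_1|+|t_2|}$, $\eta_2=\frac{|t_2|}{|t_1|+|t_2|}$, $\beta=-\frac{|t_1||t_2|}{(|t_1|+|t_2|)^2}$. Centroid: $\eta_1=\eta_2=\frac12$, $\beta=-\frac14$. In the conditions below, $d(\cdot,\cdot)$ between clusters denotes the extension of $d$ produced by a run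 of this algorithm with the given linkage. Condition A$'$: for every $(\mathcal{X},d)$, every run, every step, and all pairwise distinct active clusters $t_1,t_2,t_3,t_4$ (just before that step) such that $\{t_1,t_2\}$ is the pair selected for merging at that step: if $d(t_i,t_3)<\min(d(t_i,t_4),d(t_3,t_4))$ for $i=1,2$, then $d(t_1\cup t_2,t_3)<\min(d(t_1\cup t_2,t_4),d(t_3,t_4))$. Condition B$'$: for every $(\mathcal{X},d)$, every run, every step, and all pairwise distinct active clusters $t_1,t_2,t_3,t_4$ (just before that step) such that $\{t_3,t_4\}$ is the pair selected for merging at that step: if $d(t_1,t_2)<\min_{i\in\{1,2\},j\in\{3,4\}}d(t_i,t_j)$, then $d(t_1,t_2)<\min_{i\in\{1,2\}}d(t_i,t_3\cup t_4)$. *)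

(* Defs.v *)
From mathcomp Require Import all_boot all_order all_algebra.
From mathcomp Require Import reals.

Set Implicit Arguments.
Unset Strict Implicit.
Unset Printing Implicit Defensive.

Import Order.TTheory GRing.Theory Num.Theory.
Local Open Scope ring_scope.

Definition dissimilarity (R : realType) (X : finType) (d : X -> X -> R) : Prop :=
  [/\ forall x y, 0 <= d x y,
      forall x y, d x y = d y x
    & forall x y, x != y -> d x x < d x y].

(* The coefficients are functions of |t1|, |t2|, |t3|, where t1 and t2 are the
   merged clusters and t3 is another active cluster. *)
Record linkage (R : realType) : Type := Linkage {
  eta1 : nat -> nat -> nat -> R;
  eta2 : nat -> nat -> nat -> R;
  beta : nat -> nat -> nat -> R }.

Definition ward (R : realType) : linkage R := {|
  eta1 := fun n1 n2 n3 => (n1 + n3)%:R / (n1 + n2 + n3)%:R;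
  eta2 := fun n1 n2 n3 => (n2 + n3)%:R / (n1 + n2 + n3)%:R;
  beta := fun n1 n2 n3 => - (n3%:R / (n1 + n2 + n3)%:R) |}.

(* [median] and [centroid] are named the opposite way round from the usual
   Lance-Williams tables; the naming is deliberate. *)
Definition median (R : realType) : linkage R := {|
  eta1 := fun n1 n2 _ => n1%:R / (n1 + n2)%:R;
  eta2 := fun n1 n2 _ => n2%:R / (n1 + n2)%:R;
  beta := fun n1 n2 _ => - ((n1 * n2)%:R / (n1 + n2)%:R ^+ 2) |}.

Definition centroid (R : realType) : linkage R := {|
  eta1 := fun _ _ _ => 1 / 2;
  eta2 := fun _ _ _ => 1 / 2;
  beta := fun _ _ _ => - (1 / 4) |}.

Section Algorithm.
Variables (R : realType) (X : finType).

(* A cluster dissimilarity is a total function on pairs of sets, but only its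
   values at pairs of active clusters are ever constrained or inspected. *)
Implicit Types (C : {set {set X}}) (D : {set X} -> {set X} -> R).
Implicit Types (t u v : {set X}).

Definition updated (L : linkage R) D t1 t2 t3 : R :=
  eta1 L #|t1| #|t2| #|t3| * D t1 t3 + eta2 L #|t1| #|t2| #|t3| * D t2 t3
  + beta L #|t1| #|t2| #|t3| * D t1 t2.

Definition selected C D t1 t2 : Prop :=
  [/\ t1 \in C, t2 \in C, t1 != t2
    & forall u v, u \in C -> v \in C -> u != v -> D t1 t2 <= D u v].

(* [step L C D t1 t2 C' D']: from active clusters C with dissimilarity D, the
   pair {t1, t2} is merged, giving active clusters C' with dissimilarity D'.
   The active clusters are nonempty and pairwise disjoint, so t1 :|: t2 is not
   in C and the last two clauses are compatible. *)
Definition step (L : linkage R) C D t1 t2 C' D' : Prop :=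
  [/\ selected C D t1 t2,
      C' = (t1 :|: t2) |: (C :\: [set t1; t2]),
      forall u v, u \in C -> v \in C -> D' u v = D u v
    & forall t3, t3 \in C -> t3 != t1 -> t3 != t2 ->
        D' (t1 :|: t2) t3 = updated L D t1 t2 t3
        /\ D' t3 (t1 :|: t2) = updated L D t1 t2 t3].

(* [run L d C D]: some run on d reaches, after finitely many steps, the active
   clusters C with dissimilarity D.  Ties in [selected] are broken arbitrarily. *)
Inductive run (L : linkage R) (d : X -> X -> R) :
    {set {set X}} -> ({set X} -> {set X} -> R) -> Prop :=
| run_start D :
    (forall x y, D [set x] [set y] = d x y) ->
    run L d [set [set x] | x : X] D
| run_step C D t1 t2 C' D' :
    run L d C D -> step L C D t1 t2 C' D' -> run L d C' D'.

End Algorithm.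

Definition conditionA' (R : realType) (L : linkage R) : Prop :=
  forall (X : finType) (d : X -> X -> R), dissimilarity d ->
  forall C D, run L d C D ->
  forall t1 t2 t3 t4 C' D',
    [/\ t1 \in C, t2 \in C, t3 \in C & t4 \in C] ->
    uniq [:: t1; t2; t3; t4] ->
    step L C D t1 t2 C' D' ->
    D t1 t3 < Num.min (D t1 t4) (D t3 t4) ->
    D t2 t3 < Num.min (D t2 t4) (D t3 t4) ->
    D' (t1 :|: t2) t3 < Num.min (D' (t1 :|: t2) t4) (D' t3 t4).

Definition conditionB' (R : realType) (L : linkage R) : Prop :=
  forall (X : finType) (d : X -> X -> R), dissimilarity d ->
  forall C D, run L d C D ->
  forall t1 t2 t3 t4 C' D',
    [/\ t1 \in C, t2 \in C, t3 \in C & t4 \in C] ->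
    uniq [:: t1; t2; t3; t4] ->
    step L C D t3 t4 C' D' ->
    D t1 t2 < Num.min (Num.min (D t1 t3) (D t1 t4))
                      (Num.min (D t2 t3) (D t2 t4)) ->
    D' t1 t2 < Num.min (D' t1 (t3 :|: t4)) (D' t2 (t3 :|: t4)).

(* Main.v *)
Require Import Defs.
From mathcomp Require Import all_boot all_order all_algebra.
From mathcomp Require Import reals.
From mathcomp Require Import lra.

(** All three conditions already fail at the first merge, on four points.  For
    Ward, merge a pair at distance 2, with t3 at distance 5 from both of its
    points and all distances to t4 equal to 6: the distance from t3 to the merged
    cluster becomes (4 * 5 - 2) / 3 = 6.  For Median and Centroid, which coincide
    on singletons, take two pairs at internal distance 4 and mutual distance 5:
    merging one pair brings it to distance 5 - 4 / 4 = 4 from the other points. *)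

Set Implicit Arguments.
Unset Strict Implicit.
Unset Printing Implicit Defensive.

Import Order.TTheory GRing.Theory Num.Theory.
Local Open Scope ring_scope.

Section FirstMerge.
Variables (R : realType) (X : finType) (L : linkage R) (d : X -> X -> R).

(** Any closest pair may open a run, so refuting a condition at the first merge reduces to
    arithmetic on [d], with all cardinalities equal to 1. *)
Lemma exists_first_merge (x y : X) :
  x != y -> (forall u v, u != v -> d x y <= d u v) ->
  exists C D C' D',
    [/\ run L d C D, step L C D [set x] [set y] C' D',
        forall u, [set u] \in C,
        forall u v, D [set u] [set v] = d u v /\ D' [set u] [set v] = d u v
      & forall z, z != x -> z != y ->
        let r := eta1 L 1 1 1 * d x z + eta2 L 1 1 1 * d y z
                 + beta L 1 1 1 * d x y in
        D' ([set x] :|: [set y]) [set z] = r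
        /\ D' [set z] ([set x] :|: [set y]) = r].
Proof.
move=> neq_xy min_xy.
(* Only singletons matter here; on other sets the picked element, or the default [x], is
   arbitrary. *)
pose D (A B : {set X}) := d (odflt x [pick u in A]) (odflt x [pick u in B]).
have DE u v : D [set u] [set v] = d u v.
  have pick1 w : odflt x [pick w' in [set w]] = w.
    by case: pickP => [w' /set1P|/(_ w)] //; rewrite set11.
  by rewrite /D !pick1.
pose C := [set [set u] | u : X].
pose m := [set x] :|: [set y].
(* Having two elements, [m] is no singleton, so overriding [D] at [m] keeps its values on [C]. *)
have m_notin : m \notin C.
  apply/imsetP => -[u _ /(congr1 (fun A : {set X} => #|A|))].
  by rewrite cards2 cards1 neq_xy.
have neq_m (t : {set X}) : t \in C -> (t == m) = false.
  by move=> tC; apply: contraNF m_notin => /eqP <-.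
pose D' (A B : {set X}) :=
  if A == m then updated L D [set x] [set y] B
  else if B == m then updated L D [set x] [set y] A else D A B.
have inC u : [set u] \in C by apply: imset_f.
exists C, D, (m |: (C :\: [set [set x]; [set y]])), D'.
split=> //; first exact: run_start.
- split=> //.
  + split=> //; first by rewrite (inj_eq set1_inj).
    move=> _ _ /imsetP[u _ ->] /imsetP[v _ ->].
    by rewrite (inj_eq set1_inj) !DE; apply: min_xy.
  + by move=> s t sC tC; rewrite /D' !neq_m.
  + by move=> t tC _ _; rewrite /D' -/m eqxx neq_m.
- by move=> u v; rewrite /D' !neq_m.
- by move=> z _ _; rewrite /D' -/m eqxx neq_m // /updated !cards1 !DE.
Qed.

End FirstMerge.

Lemma natr_dissimilarity (R : realType) (X : finType) (d : X -> X -> nat) :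
  (forall x y, d x y = d y x) -> (forall x y, x != y -> d x x < d x y)%N ->
  dissimilarity (fun x y => (d x y)%:R : R).
Proof.
move=> d_sym d_lt; split=> [x y|x y|x y neq_xy]; first exact: ler0n.
  by rewrite d_sym.
by rewrite ltr_nat d_lt.
Qed.

(** First coordinate [true] marks the pair to merge; [(false, true)] serves as [t3] and
    [(false, false)] as [t4]. *)
Definition ward_dist (x y : bool * bool) : nat :=
  (if x == y then 0
   else if x.1 && y.1 then 2
   else if (x == (false, false)) || (y == (false, false)) then 6
   else 5)%N.

Lemma ward_not_conditionA' (R : realType) : ~ conditionA' (ward R).
Proof.
pose d x y : R := (ward_dist x y)%:R.
have d_diss : dissimilarity d by apply: natr_dissimilarity => -[[] []] [[] []].
have [||C [D [C' [D' [runD stepD inC DE mergedE]]]]] :=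
  @exists_first_merge R _ (ward R) d (true, true) (true, false).
- by [].
- by move=> [[] []] [[] []]; rewrite // /d ler_nat.
move=> /(_ _ d d_diss C D runD [set (true, true)] [set (true, false)]
           [set (false, true)] [set (false, false)] C' D').
have [-> _] := mergedE (false, true) isT isT.
rewrite !(fun u v => (DE u v).1) (DE _ _).2 /d /=.
rewrite !inE !(inj_eq set1_inj) !lt_min !ltr_nat /=.
move=> /(_ (And4 (inC _) (inC _) (inC _) (inC _)) isT stepD isT isT).
(* The bound by the distance from [t3] to [t4] reads [6 < 6]. *)
by rewrite /ward_dist -[(1 + 1 + 1)%N]/3%N -[(1 + 1)%N]/2%N /= => /andP[_]; lra.
Qed.

(** The first coordinate names the pair. The two pairs tie for the minimum, so either may be merged
    first. *)
Definition two_pairs_dist (x y : bool * bool) : nat :=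
  (if x == y then 0 else if x.1 == y.1 then 4 else 5)%N.

(** A first merge only sees the coefficients at cardinalities 1, so one example serves both
    linkages. *)
Lemma not_conditionB' (R : realType) (L : linkage R) :
  eta1 L 1 1 1 = 1 / 2 -> eta2 L 1 1 1 = 1 / 2 -> beta L 1 1 1 = - (1 / 4) ->
  ~ conditionB' L.
Proof.
move=> eta1E eta2E betaE.
pose d x y : R := (two_pairs_dist x y)%:R.
have d_diss : dissimilarity d by apply: natr_dissimilarity => -[[] []] [[] []].
have [||C [D [C' [D' [runD stepD inC DE mergedE]]]]] :=
  @exists_first_merge R _ L d (true, true) (true, false).
- by [].
- by move=> [[] []] [[] []]; rewrite // /d ler_nat.
move=> /(_ _ d d_diss C D runD [set (false, true)] [set (false, false)]
           [set (true, true)] [set (true, false)] C' D').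
have [_ ->] := mergedE (false, true) isT isT.
rewrite !(fun u v => (DE u v).1) (DE _ _).2 /d eta1E eta2E betaE /=.
rewrite !inE !(inj_eq set1_inj) !lt_min !ltr_nat /=.
move=> /(_ (And4 (inC _) (inC _) (inC _) (inC _)) isT stepD isT).
(* The bound at [t1] reads [4 < 4]. *)
by rewrite /two_pairs_dist /= => /andP[+ _]; lra.
Qed.

Theorem lemma5 (R : realType) :
  ~ conditionA' (ward R) /\
  ~ conditionB' (median R) /\
  ~ conditionB' (centroid R).
Proof.
split; first exact: ward_not_conditionA'.
by split; apply: not_conditionB' => //=; rewrite -[(1 + 1)%N]/2%N; lra.
Qed.
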